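(* Let $H$ be a complex Hilbert space and let $T=A+\mathrm{i}B\in B(H)$, where $A,B\in B(H)$ are self-adjoint. Let $n\in\mathbb{N}$ be such that $n\geq 2$. Suppose that $T^{2n+1}$ and $T^2$ are self-adjoint and that $A\geq 0$. Then $T$ is self-adjoint.
   Context: $H$ is a complex Hilbert space (possibly infinite-dimensional) and $B(H)$ is the algebra of bounded linear operators from $H$ into itself. For $S\in B(H)$, $S\geq 0$ (positive) means $\langle Sx,x\rangle\geq 0$ for all $x\in H$. *)

(* Defs.v *)
From HB Require Import structures.
From mathcomp Require Import all_boot all_order all_algebra.
From mathcomp Require Import complex.
From mathcomp Require Import all_classical all_reals all_analysis.

Set Implicit Arguments.
Unset Strict Implicit.
Unset Printing Implicit Defensive.

Import Order.TTheory GRing.Theory Num.Theory.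
Import numFieldNormedType.Exports.

Local Open Scope classical_set_scope.
Local Open Scope ring_scope.

(* The norm of a [normedModType R[i]] takes its values in [R[i]].  Positive
   definiteness of the inner product follows from [inner_norm]. *)
HB.mixin Record CompleteNormedModule_isHilbert (R : realType) H
    & CompleteNormedModule R[i] H := {
  inner : H -> H -> R[i];
  inner_linearl : forall (a : R[i]) (x y z : H),
    inner (a *: x + y) z = a * inner x z + inner y z;
  inner_conjC : forall x y : H, inner x y = (inner y x)^*;
  inner_norm : forall x : H, `|x| ^+ 2 = inner x x
}.

#[short(type="hilbertType")]
HB.structure Definition Hilbert (R : realType) :=
  {H of CompleteNormedModule_isHilbert R H & CompleteNormedModule R[i] H}.

Section InnerDot.
Variables (R : realType) (H : hilbertType R).

Fact inner_bilinear :
  bilinear_for *%R (Num.conj \; *%R) (@inner R H : H -> H -> R[i]).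
Proof.
split=> [z a x y|z a x y]; first exact: inner_linearl.
by rewrite /= inner_conjC inner_linearl rmorphD rmorphM /= -!inner_conjC.
Qed.

HB.instance Definition _ := bilinear_isBilinear.Build R[i] H H R[i]
  *%R (Num.conj \; *%R) (@inner R H) inner_bilinear.

Fact inner_hermitian (x y : H) :
  inner x y = (-1) ^+ false * Num.conj (inner y x).
Proof. by rewrite expr0 mul1r inner_conjC. Qed.

HB.instance Definition _ := isHermitianSesquilinear.Build R[i] H
  false Num.conj (@inner R H) inner_hermitian.

Fact inner_gt0 (x : H) : x != 0 -> 0 < inner x x.
Proof. by move=> x0; rewrite -inner_norm exprn_gt0 ?normr_gt0. Qed.

HB.instance Definition _ :=
  isDotProduct.Build R[i] H (@inner R H) inner_gt0.

End InnerDot.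

Definition bounded_op (R : realType) (H : hilbertType R) (S : {linear H -> H}) :=
  exists M : R, forall x : H, `|S x| <= M%:C%C * `|x|.

Lemma bounded_opP (R : realType) (H : hilbertType R) (S : {linear H -> H}) :
  bounded_op S <-> continuous S.
Proof.
split.
  move=> [M hM]; apply: bounded_linear_continuous; apply/bounded_funP => r.
  exists (`|M%:C%C| * r) => x xr; apply: le_trans (hM x) _.
  have h0 : 0 <= M%:C%C * `|x| by apply: le_trans (hM x).
  by rewrite -(ger0_norm h0) normrM normr_id ler_wpM2l.
move=> /(_ 0) /(continuous_linear_bounded 0) /linear_boundedP.
move=> /pinfty_ex_gt0 [M M0 hM].
exists (complex.Re M) => x; rewrite RRe_real ?hM //.
by rewrite realE ltW.
Qed.

(* [S^*] is characterized by [<S x, y> = <x, S^* y>] for all x and y. *)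
Definition is_adjoint (R : realType) (H : hilbertType R) (S S' : H -> H) :=
  forall x y : H, inner (S x) y = inner x (S' y).

Definition selfadjoint (R : realType) (H : hilbertType R) (S : H -> H) :=
  is_adjoint S S.

(* In [R[i]], [0 <= z] means that z is real and nonnegative. *)
Definition positive_op (R : realType) (H : hilbertType R) (S : H -> H) :=
  forall x : H, 0 <= inner (S x) x.

(* Main.v *)
Require Import Defs.
From mathcomp Require Import all_boot all_order all_algebra.
From mathcomp Require Import complex.
From mathcomp Require Import all_classical all_reals all_analysis.
From mathcomp Require Import lra.

(** Write [T = A + D] with [D = 'i B], so that [D] is skew-adjoint.

    The skew-adjoint part of [T^2] is [A D + D A]; hence [T^2] self-adjoint
    means that [A] and [D] anticommute.  In finite dimension positivity of [A]
    would then give [A D = 0]: [D] maps the eigenspace of [A] for [a > 0] into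
    the one for [- a], which is zero.  In infinite dimension the same effect
    is obtained from growth rates ([form_anticommuting_le0]).  For a
    bound [M > 0] of [A], anticommutation gives
    [(M + A)^k D = D (M - A)^k].  As [0 <= A <= M], the norm of the right-hand
    side at [x] is [O(M^k)], while the squared norm of the left-hand side is at
    least [M^(2k) 2k <A D x, D x> / M]; letting [k] grow, [<A D x, D x> = 0],
    and so [A D x = 0] because [A >= 0].

    Now [A D = D A = 0], so [T^m = A^m + D^m] for [m >= 1].  If [m] is odd and
    [T^m] is self-adjoint, then [D^m] is both self-adjoint and skew-adjoint,
    hence zero; and a nilpotent skew-adjoint operator is zero
    ([skew_nilpotent]).  Thus [T = A].

    Only the real part of the inner product is used, so that all inequalities
    live in the ordered field [R]. *)

Set Implicit Arguments.
Unset Strict Implicit.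
Unset Printing Implicit Defensive.

Import Order.TTheory GRing.Theory Num.Theory.

Local Open Scope ring_scope.

(** * The real inner product *)

Definition rdot (R : realType) (H : hilbertType R) (x y : H) : R :=
  complex.Re (inner x y).

Section RealInnerProduct.
Variables (R : realType) (H : hilbertType R).
Implicit Types (x y z : H) (t : R).

Lemma rdotC x y : rdot x y = rdot y x.
Proof. by rewrite /rdot inner_conjC; case: (inner y x). Qed.

Lemma rdotDl x y z : rdot (x + y) z = rdot x z + rdot y z.
Proof. by rewrite /rdot linearDl raddfD. Qed.

Lemma rdotDr x y z : rdot z (x + y) = rdot z x + rdot z y.
Proof. by rewrite !(rdotC z) rdotDl. Qed.

Lemma rdot0l x : rdot 0 x = 0.
Proof. by rewrite /rdot linear0l. Qed.

Lemma rdotNl x y : rdot (- x) y = - rdot x y.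
Proof. by rewrite /rdot linearNl raddfN. Qed.

Lemma rdotNr x y : rdot y (- x) = - rdot y x.
Proof. by rewrite !(rdotC y) rdotNl. Qed.

Lemma rdotZl t x y : rdot (t%:C%C *: x) y = t * rdot x y.
Proof.
rewrite /rdot linearZl_LR /=; case: (inner x y) => a b /=.
by rewrite mul0r subr0.
Qed.

Lemma rdotZr t x y : rdot y (t%:C%C *: x) = t * rdot y x.
Proof. by rewrite !(rdotC y) rdotZl. Qed.

Definition rdotE := (rdotDl, rdotDr, rdotNl, rdotNr, rdotZl, rdotZr).

Lemma rdot_norm x : `|x| ^+ 2 = (rdot x x)%:C%C.
Proof.
have : 0 <= inner x x by rewrite -inner_norm exprn_ge0.
by rewrite inner_norm /rdot lecE => /andP[/eqP]; case: (inner x x) => a b /= ->.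
Qed.

Lemma rdot_ge0 x : 0 <= rdot x x.
Proof. by have := exprn_ge0 2 (normr_ge0 x); rewrite rdot_norm lecR. Qed.

Lemma rdot_eq0 x : rdot x x <= 0 -> x = 0.
Proof.
move=> xle0; have xx0 : rdot x x = 0 by apply/eqP; rewrite eq_le xle0 rdot_ge0.
by apply/eqP; rewrite -normr_eq0 -sqrf_eq0 rdot_norm xx0.
Qed.

Lemma bounded_op_rdot (S : {linear H -> H}) : bounded_op S ->
  exists2 M, 0 < M & forall x, rdot (S x) (S x) <= M ^+ 2 * rdot x x.
Proof.
move=> [M SM]; exists (`|M| + 1); first by rewrite ltr_wpDl.
move=> x; have xge0 := rdot_ge0 x.
suff : rdot (S x) (S x) <= M ^+ 2 * rdot x x.
  move/le_trans; apply; rewrite ler_wpM2r // -real_normK ?num_real //.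
  by rewrite ler_sqr ?nnegrE ?addr_ge0 // lerDl.
rewrite -lecR rmorphM rmorphXn /= -!rdot_norm -exprMn.
by rewrite ler_sqr ?nnegrE // (le_trans _ (SM x)).
Qed.

Lemma rdot_selfadjoint (S : H -> H) : selfadjoint S ->
  forall x y, rdot (S x) y = rdot x (S y).
Proof. by move=> Ssa x y; rewrite /rdot Ssa. Qed.

Lemma rdot_positive (S : H -> H) : positive_op S ->
  forall x, 0 <= rdot (S x) x.
Proof. by move=> Sge0 x; have := Sge0 x; rewrite lecE => /andP[]. Qed.

End RealInnerProduct.

(** * Positive operators anticommuting with a bounded operator *)

Section Anticommuting.
Variables (R : realType) (H : hilbertType R) (A : {linear H -> H}) (M : R).
Hypothesis M_gt0 : 0 < M.
Hypothesis A_bounded : forall x, rdot (A x) (A x) <= M ^+ 2 * rdot x x.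
Hypothesis A_sym : forall x y, rdot (A x) y = rdot x (A y).
Hypothesis A_ge0 : forall x, 0 <= rdot (A x) x.

(** This is [A^2 <= M A].  It is read off from positivity of [A] at
    [M x - A x], after [A <= M] has been applied to [A x]; the latter comes
    from [|M y - A y|^2 >= 0]. *)
Lemma positive_sqr_form_le x : rdot (A x) (A x) <= M * rdot (A x) x.
Proof.
have AleM y : rdot (A y) y <= M * rdot y y.
  have := rdot_ge0 (M%:C%C *: y - A y); have := A_bounded y.
  rewrite !rdotE (rdotC y (A y)) => Ay yAy.
  by rewrite -(ler_pM2l M_gt0); lra.
have := A_ge0 (M%:C%C *: x - A x); have := AleM (A x).
rewrite linearB linearZ /= !rdotE (A_sym (A x) x) => AAx xAx.
by rewrite -(ler_pM2l M_gt0); lra.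
Qed.

(** [P] and [Q] are intertwined by an operator anticommuting with [A], yet [P]
    stretches vectors by at least [M] while [Q] by at most [M]. *)
Let P x := M%:C%C *: x + A x.
Let Q x := M%:C%C *: x - A x.

(** [|(M - A) z|^2 = M^2 |z|^2 - 2 M <A z, z> + |A z|^2], and the last two
    terms have a nonpositive sum because [A^2 <= M A]. *)
Lemma iter_sub_le k x :
  rdot (iter k Q x) (iter k Q x) <= (M ^+ 2) ^+ k * rdot x x.
Proof.
elim: k => [|k IHk]; first by rewrite mul1r.
rewrite iterS [_ ^+ k.+1]exprS -mulrA; set z := iter k Q x in IHk *.
apply: (@le_trans _ _ (M ^+ 2 * rdot z z)).
  have := positive_sqr_form_le z; have := A_ge0 z.
  rewrite /Q !rdotE (rdotC z (A z)).
  by move=> /(mulr_ge0 (ltW M_gt0)); lra.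
by rewrite ler_pM2l // exprn_gt0.
Qed.

Lemma iter_add_form_ge k y :
  (M ^+ 2) ^+ k * rdot (A y) y <= rdot (A (iter k P y)) (iter k P y).
Proof.
elim: k => [|k IHk]; first by rewrite mul1r.
rewrite iterS [_ ^+ k.+1]exprS -mulrA; set z := iter k P y in IHk *.
have M2 : 0 < M ^+ 2 by rewrite exprn_gt0.
apply: (@le_trans _ _ (M ^+ 2 * rdot (A z) z)); first by rewrite ler_pM2l.
have := A_ge0 (A z); have := mulr_ge0 (ltW M_gt0) (rdot_ge0 (A z)).
by rewrite /P linearD linearZ /= !rdotE (A_sym (A z) z); lra.
Qed.

(** The factor [k] comes from the cross term of [|(M + A) z|^2], which
    contributes the same amount, up to the factor [M^(2k)], at every step. *)
Lemma iter_add_ge k y :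
  (M ^+ 2) ^+ k * (2 * k%:R * rdot (A y) y)
    <= M * rdot (iter k P y) (iter k P y).
Proof.
elim: k => [|k IHk]; first by rewrite mulr0 mul0r mulr0 mulr_ge0 ?rdot_ge0 ?ltW.
have := iter_add_form_ge k y.
rewrite iterS [_ ^+ k.+1]exprS -[k.+1%:R]natr1; set z := iter k P y in IHk *.
set c := rdot (A y) y in IHk *; set m := (M ^+ 2) ^+ k in IHk *.
have M2 : 0 < M ^+ 2 by rewrite exprn_gt0.
rewrite -(ler_pM2l M2) in IHk => /(ler_wpM2l (ltW M2)) mcz.
have := mulr_ge0 (ltW M_gt0) (rdot_ge0 (A z)).
by rewrite /P !rdotE (rdotC z (A z)); lra.
Qed.

Variables (D : {linear H -> H}) (N : R).
Hypothesis D_bounded : forall x, rdot (D x) (D x) <= N ^+ 2 * rdot x x.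
Hypothesis AD_anticomm : forall x, A (D x) = - D (A x).

Lemma iter_add_comp k x : iter k P (D x) = D (iter k Q x).
Proof.
by elim: k => //= k ->; rewrite {1}/P /Q linearB linearZ /= AD_anticomm.
Qed.

(** Comparing the two growth rates gives [2 k c <= C] for all [k], with
    [c = <A D x, D x>] and [C] independent of [k]. *)
Lemma form_anticommuting_le0 x : rdot (A (D x)) (D x) <= 0.
Proof.
set c := rdot _ _; set C := M * (N ^+ 2 * rdot x x).
have kc k : 2 * k%:R * c <= C.
  have Mk : 0 < (M ^+ 2) ^+ k by rewrite !exprn_gt0.
  rewrite -(ler_pM2l Mk); apply: le_trans (iter_add_ge k (D x)) _.
  rewrite iter_add_comp mulrCA ler_pM2l //; apply: le_trans (D_bounded _) _.
  by rewrite mulrCA ler_wpM2l ?sqr_ge0 ?iter_sub_le.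
rewrite leNgt; apply/negP => c_gt0.
have := kc (Num.truncn (C / c)).+1; have := truncnS_gt (C / c).
rewrite ltr_pdivrMr // => Cc kC.
have : 0 <= (Num.truncn (C / c)).+1%:R * c by rewrite mulr_ge0 ?ltW.
by lra.
Qed.

Lemma comp_anticommuting_eq0 x : A (D x) = 0.
Proof.
apply: rdot_eq0; apply: le_trans (positive_sqr_form_le _) _.
by rewrite pmulr_rle0 // form_anticommuting_le0.
Qed.

End Anticommuting.

(** * Powers of self-adjoint and skew-adjoint operators *)

Section Powers.
Variables (R : realType) (H : hilbertType R) (D : {linear H -> H}).

Lemma iter_sym (A : H -> H) k :
  (forall x y, rdot (A x) y = rdot x (A y)) ->
  forall x y, rdot (iter k A x) y = rdot x (iter k A y).
Proof. by move=> Asym; elim: k => //= k IHk x y; rewrite Asym IHk -iterSr. Qed.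

Hypothesis D_skew : forall x y, rdot (D x) y = - rdot x (D y).

Lemma iter_skew k x y :
  rdot (iter k D x) y = (-1) ^+ k * rdot x (iter k D y).
Proof.
elim: k x y => [|k IHk] x y; first by rewrite mul1r.
by rewrite iterS D_skew IHk -iterSr exprS mulN1r mulNr.
Qed.

(** If [D^(k+2) = 0], then [|D^(k+1) x|^2 = - <D^k x, D^(k+2) x> = 0], so the
    exponent can be lowered down to one. *)
Lemma skew_nilpotent k : (forall x, iter k.+1 D x = 0) -> forall x, D x = 0.
Proof.
elim: k => [//|k IHk] Dk; apply: IHk => x; apply: rdot_eq0.
by rewrite {1}iterS D_skew -iterS Dk rdotC rdot0l oppr0.
Qed.

End Powers.

Theorem theorem3p1 (R : realType) (H : hilbertType R)
    (T A B : {linear H -> H}) (n : nat) :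
  bounded_op T -> bounded_op A -> bounded_op B ->
  selfadjoint A -> selfadjoint B ->
  (forall x : H, T x = A x + 'i *: B x) ->
  (2 <= n)%N ->
  selfadjoint (iter (2 * n + 1) T) ->
  selfadjoint (iter 2 T) ->
  positive_op A ->
  selfadjoint T.
Proof.
move=> _ /bounded_op_rdot[M M_gt0 A_bounded] B_bounded Asa Bsa TE _.
move=> /rdot_selfadjoint Todd_sym /rdot_selfadjoint T2_sym /rdot_positive A_ge0.
have A_sym := rdot_selfadjoint Asa.
pose D : {linear H -> H} := 'i \*: B.
have DE x : D x = 'i *: B x by [].
have D_skew x y : rdot (D x) y = - rdot x (D y).
  rewrite /rdot !DE linearZl_LR linearZr_LR /= Bsa conjCi mulNr.
  by rewrite raddfN opprK.
have /bounded_op_rdot[N _ D_bounded] : bounded_op D.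
  case: B_bounded => N BN; exists N => x.
  by rewrite DE normrZ normCi mul1r.
have AD_anticomm x : A (D x) = - D (A x).
  have Dr u v : rdot u (D v) = - rdot (D u) v by rewrite D_skew opprK.
  (* this is the skew-adjoint part of [T^2], tested against [w] *)
  suff ADw w : rdot (A (D x) + D (A x)) w = 0.
    by apply/eqP; rewrite -addr_eq0; apply/eqP/rdot_eq0; rewrite ADw.
  have := T2_sym x w; rewrite /= !TE -!DE !linearD !rdotE.
  by rewrite -!A_sym !Dr -!A_sym; lra.
have AD0 := comp_anticommuting_eq0 M_gt0 A_bounded A_sym A_ge0
  D_bounded AD_anticomm.
have DA0 x : D (A x) = 0 by rewrite -[LHS]opprK -AD_anticomm AD0 oppr0.
have T_iter k x : iter k.+1 T x = iter k.+1 A x + iter k.+1 D x.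
  elim: k => [|k IHk]; first exact: TE.
  rewrite iterS IHk TE -DE !linearD -!iterS.
  by rewrite [iter k.+1 D x]iterS AD0 [iter k.+1 A x]iterS DA0 addr0 add0r.
suff D0 x : D x = 0 by move=> x y; rewrite !TE -!DE !D0 !addr0 Asa.
move: x; apply: (skew_nilpotent D_skew (k := 2 * n)) => x; apply: rdot_eq0.
(* [D^(2n+1)] is self-adjoint, as [A^(2n+1)] and [T^(2n+1)] are, and skew *)
set w := iter _ _ _; have := Todd_sym x w; rewrite addn1 !T_iter !rdotE.
rewrite (iter_sym _ A_sym) => /addrI; rewrite -/w.
have := iter_skew D_skew (2 * n).+1 x w.
by rewrite -/w exprS exprM sqrrN !expr1n mulr1 mulN1r; lra.
Qed.
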